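(* There exists $\varepsilon>0$ such that, for every non-constant monotone function $f:\{0,1\}^m\to\{0,1\}$ and every sufficiently large $n\in\mathbb{N}$, it holds that $$\log\mathsf{L}(\mathit{mKW}_f\diamond\mathit{mKW}_{\textsc{Gen}_n})\ge\log\mathsf{L}(\mathit{mKW}_f)+\Omega(n^{\varepsilon}).$$
   Context: All logarithms are base 2. ''Sufficiently large $n$'' means larger than a threshold that may depend on $m$; $A\ge B+\Omega(E)$ means $A\ge B+\kappa E$ for some absolute constant $\kappa>0$ (for all sufficiently large $n$). Given $\mathcal{T}\subseteq[n]^3$, $\mathcal{T}$ generates a point $w\in[n]$ if $w=1$, or if there is a triplet $(u,v,w)\in\mathcal{T}$ such that $\mathcal{T}$ generates $u$ and $v$ (inductive definition, i.e., the smallest such set of points). The function $\textsc{Gen}_n$ takes as input a set $\mathcal{T}\subseteq[n]^3$ (encoded by its characteristic vector in $\{0,1\}^{n^3}$) and outputs 1 iff $\mathcal{T}$ generates $n$. A communication problem $P\subseteq\mathcal{X}\times\mathcal{Y}\times\mathcal{O}$: Alice gets $x\in\mathcal{X}$, Bob gets $y\in\mathcal{Y}$, and they must output some $o$ with $(x,y,o)\in P$. Protocols are deterministic binary trees; $\mathsf{L}(P)$ is the minimal number of leaves of a protocol solving $P$. For a non-constant monotone $h:\{0,1\}^N\to\{0,1\}$, $\mathit{mKW}_h$: Alice gets $x\in h^{-1}(1)$, Bob gets $y\in h^{-1}(0)$, and they must find $i\in[N]$ with $x_i>y_i$. For monotone $g:\{0,1\}^N\to\{0,1\}$, $\mathit{mKW}_f\diamond\mathit{mKW}_g$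 denotes $\mathit{mKW}_{f\diamond g}$, where $f\diamond g(x_1,\dots,x_m)=f(g(x_1),\dots,g(x_m))$ for $x_i\in\{0,1\}^N$. *)

(* Defs.v *)
From HB Require Import structures.
From mathcomp Require Import all_boot all_order all_algebra.
From mathcomp Require Import boolp reals exp.

Set Implicit Arguments.
Unset Strict Implicit.
Unset Printing Implicit Defensive.

(** * Communication problems and protocols *)

Section Communication.
Variables X Y O : Type.

Definition problem := X -> Y -> O -> Prop.

Inductive protocol :=
| Leaf of O
| Alice of (X -> bool) & protocol & protocol
| Bob of (Y -> bool) & protocol & protocol.

Fixpoint run (p : protocol) (x : X) (y : Y) : O :=
  match p with
  | Leaf o => o
  | Alice a p0 p1 => if a x then run p1 x y else run p0 x y
  | Bob b p0 p1 => if b y then run p1 x y else run p0 x y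
  end.

Fixpoint leaves (p : protocol) : nat :=
  match p with
  | Leaf _ => 1
  | Alice _ p0 p1 => leaves p0 + leaves p1
  | Bob _ p0 p1 => leaves p0 + leaves p1
  end.

Definition solves (P : problem) (p : protocol) : Prop :=
  forall x y, P x y (run p x y).

Definition solvable_with (P : problem) (k : nat) : Prop :=
  exists p, solves P p /\ leaves p = k.

(* The default 0 is returned only when no protocol solves P; by [LP] and
   [mKW_solvable] this never happens for [mKW h] with h monotone and
   non-constant, in particular for h = f <> Gen_n with 1 < n (see
   [bcomp_Gen_solvable]). *)
Definition L (P : problem) : nat :=
  if pselect (exists k, `[< solvable_with P k >]) is left ex
  then ex_minn ex else 0.

Lemma LP (P : problem) : (exists p, solves P p) ->
  (exists p, solves P p /\ leaves p = L P) /\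
  (forall p, solves P p -> L P <= leaves p).
Proof.
move=> [p0 hp0]; rewrite /L; case: pselect => [ex|[]].
  case: ex_minnP => k /asboolP hk hmin; split=> // p hp.
  by apply: hmin; apply/asboolP; exists p.
by exists (leaves p0); apply/asboolP; exists p0.
Qed.

End Communication.

(** * Monotone boolean functions and Karchmer-Wigderson relations *)

(* {0,1}^N is represented as {ffun I -> bool} with I a finite index type of
   cardinality N, so that composed functions need no re-indexing. *)
Section BooleanFunctions.
Variable I : finType.
Implicit Type h : {ffun I -> bool} -> bool.

Definition monotone h : Prop :=
  forall x y : {ffun I -> bool}, (forall i, x i ==> y i) -> h x ==> h y.

Definition nonconstant h : Prop := exists x y, h x != h y.

Definition mKW h : problem {x | h x} {y | ~~ h y} I :=
  fun x y i => val x i && ~~ val y i.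

End BooleanFunctions.

Arguments monotone {I} h.
Arguments nonconstant {I} h.
Arguments mKW {I} h x y i.

Definition bcomp (I J : finType) (f : {ffun I -> bool} -> bool)
    (g : {ffun J -> bool} -> bool) (x : {ffun I * J -> bool}) : bool :=
  f [ffun i => g [ffun j => x (i, j)]].

Lemma finite_solvable (X Y : finType) (O : Type) (o : O) (P : problem X Y O) :
  (forall x y, exists o, P x y o) -> exists p, solves P p.
Proof.
move=> tot.
have HB (x : X) (s : seq Y) :
    exists p : protocol X Y O, forall y, y \in s -> P x y (run p x y).
  elim: s => [|y s [p hp]]; first by exists (Leaf _ _ o).
  have [o' ho'] := tot x y.
  exists (Bob (fun y' => y' == y) p (Leaf _ _ o')) => y'.
  by rewrite inE /=; case: eqP => [->|_] //= /hp.
have HA (s : seq X) :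
    exists p : protocol X Y O, forall x y, x \in s -> P x y (run p x y).
  elim: s => [|x s [p hp]]; first by exists (Leaf _ _ o).
  have [q hq] := HB x (enum Y).
  exists (Alice (fun x' => x' == x) p q) => x' y.
  rewrite inE /=; case: eqP => [->|_] /=; last exact: hp.
  by move=> _; apply: hq; rewrite mem_enum.
by have [p hp] := HA (enum X); exists p => x y; apply: hp; rewrite mem_enum.
Qed.

Lemma mKW_solvable (I : finType) (h : {ffun I -> bool} -> bool) :
  monotone h -> nonconstant h -> exists p, solves (mKW h) p.
Proof.
move=> mon [x [y hxy]].
have tot (x' : {x | h x}) (y' : {y | ~~ h y}) : exists i, mKW h x' y' i.
  apply: contrapT => no; have := valP y'.
  suff le : forall i, val x' i ==> val y' i.
    by have := mon _ _ le; rewrite (valP x') /= => ->.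
  move=> i; apply/implyP => xi; apply: contrapT => /negP yi.
  by apply: no; exists i; rewrite /mKW xi.
have [i _] : exists i : I, true.
  case: (boolP (h x)) hxy => hx; case: (boolP (h y)) => // hy _.
  - by have [i _] := tot (exist _ x hx) (exist _ y hy); exists i.
  - by have [i _] := tot (exist _ y hy) (exist _ x hx); exists i.
exact: finite_solvable.
Qed.

(** * The generation problem *)

(* The points 1, ..., n of [n] are the ordinals 0, ..., n.-1 of 'I_n. *)
Inductive generates (n : nat) (T : {set 'I_n * 'I_n * 'I_n}) : 'I_n -> Prop :=
| generates_one (w : 'I_n) : val w = 0 -> generates T w
| generates_triplet (u v w : 'I_n) :
    (u, v, w) \in T -> generates T u -> generates T v -> generates T w.

Definition Gen (n : nat) (x : {ffun 'I_n * 'I_n * 'I_n -> bool}) : bool :=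
  `[< exists w : 'I_n, val w = n.-1 /\ generates [set t | x t] w >].

Arguments Gen n x : clear implicits.

Lemma Gen_monotone n : monotone (Gen n).
Proof.
move=> x y le; apply/implyP => /asboolP [w [wn gw]]; apply/asboolP.
exists w; split=> //; elim: gw => [w' h|u v w' uvw _ gu _ gv].
  exact: generates_one.
apply: generates_triplet gu gv; move: uvw; rewrite !inE => xuvw.
by have := le (u, v, w'); rewrite xuvw.
Qed.

Lemma Gen0 n : 1 < n -> Gen n [ffun=> false] = false.
Proof.
move=> n1; apply/asboolP => -[w [wn gw]].
case: gw wn => [w' -> | u v w']; first by case: n n1 {w w'} => [|[]].
by rewrite !inE ffunE.
Qed.

Lemma Gen1 n : 0 < n -> Gen n [ffun=> true] = true.
Proof.
case: n => // n _; apply/asboolP; exists ord_max; split=> //.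
have g0 : generates [set t | [ffun=> true] t] (ord0 : 'I_n.+1).
  exact: generates_one.
by apply: (generates_triplet _ g0 g0); rewrite inE ffunE.
Qed.

Lemma bcomp_Gen_solvable m n (f : {ffun 'I_m -> bool} -> bool) :
  monotone f -> nonconstant f -> 1 < n ->
  exists p, solves (mKW (bcomp f (Gen n))) p.
Proof.
move=> mon [x [y xy]] n1; apply: mKW_solvable.
  move=> a b le; apply: mon => i; rewrite !ffunE; apply: Gen_monotone => j.
  by rewrite !ffunE.
have lift (z : {ffun 'I_m -> bool}) :
    bcomp f (Gen n) [ffun ij => z ij.1] = f z.
  congr f; apply/ffunP => i; rewrite ffunE.
  transitivity (Gen n [ffun=> z i]).
    by congr Gen; apply/ffunP => j; rewrite !ffunE.
  by case: (z i); [apply: Gen1; apply: ltnW | apply: Gen0].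
by exists [ffun ij => x ij.1], [ffun ij => y ij.1]; rewrite !lift.
Qed.

Definition log2 (R : realType) (x : R) : R := (ln x / ln 2)%R.

(* Main.v *)
Require Import Defs.
From mathcomp Require Import all_boot all_order all_algebra.
From mathcomp Require Import boolp reals exp.
From mathcomp Require Import zify.
Import Order.TTheory GRing.Theory Num.Theory.

(* Since the threshold on n may depend on m, the finitely many constants
   L(mKW_f) are absorbed by the exponential lower bound for GEN, and a protocol
   for the composition restricts to one for GEN along a critical input of f.

   GEN is bounded by a rank argument over GF(2).  Take the (h+1) x (h+1) grid as
   a DAG with vertex set V, and lift each vertex v to the points (v, i), i in T.
   Alice holds a : V -> T and the rules deriving (v, a v) from the predecessors
   of v; Bob holds b : V -> T and a set w of vertices, and rejects through the
   cut {(v, b v) | v in w}.  A leaf names a rule falsified by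
   z = {v in w | a v = b v}.  Let e(S) say that S has at most h vertices and
   does not block all paths to the sink (so e is invariant under reversible
   pebbling moves), and let gap(z) be the sum of e(S) over S containing z.  Then
   the sum of gap(z) over w is [a = b], an identity matrix of rank |T|^|V|,
   whereas on a rectangle with a common falsified rule only the sets S of size
   exactly h survive, each contributing rank at most |T|^(|V|-h). *)

Set Implicit Arguments.
Unset Strict Implicit.
Unset Printing Implicit Defensive.


(** * Protocols *)

(** Induction on the protocol: each query splits the rectangle [alpha] x [beta], [mu] is subadditive
    under the split, and every leaf pays at most [K]. *)
Lemma leaves_subadditive (X Y O A B : Type) (phi : A -> X) (psi : B -> Y)
    (valid : A -> B -> O -> Prop) (mu : (A -> bool) -> (B -> bool) -> nat)
    (K : nat) :
  (forall alpha beta c, mu alpha beta <=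
     mu (fun a => alpha a && c a) beta + mu (fun a => alpha a && ~~ c a) beta) ->
  (forall alpha beta c, mu alpha beta <=
     mu alpha (fun b => beta b && c b) + mu alpha (fun b => beta b && ~~ c b)) ->
  (forall (alpha : A -> bool) (beta : B -> bool) o,
     (forall a b, alpha a -> beta b -> valid a b o) -> mu alpha beta <= K) ->
  forall (p : protocol X Y O) (alpha : A -> bool) (beta : B -> bool),
    (forall a b, alpha a -> beta b -> valid a b (run p (phi a) (psi b))) ->
    mu alpha beta <= leaves p * K.
Proof.
move=> muA muB mu_leaf; elim=> [o|c p0 IH0 p1 IH1|c p0 IH0 p1 IH1] alpha beta /=.
- by rewrite mul1n; apply: mu_leaf.
- move=> ok; apply: (leq_trans (muA _ _ (fun a => c (phi a)))).
  rewrite addnC mulnDl leq_add //.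
    by apply: IH0 => a b /andP[aa /negbTE ca] bb; have := ok a b aa bb; rewrite ca.
  by apply: IH1 => a b /andP[aa ca] bb; have := ok a b aa bb; rewrite ca.
- move=> ok; apply: (leq_trans (muB _ _ (fun b => c (psi b)))).
  rewrite addnC mulnDl leq_add //.
    by apply: IH0 => a b aa /andP[bb /negbTE cb]; have := ok a b aa bb; rewrite cb.
  by apply: IH1 => a b aa /andP[bb cb]; have := ok a b aa bb; rewrite cb.
Qed.

Fixpoint pullback (X Y O X' Y' O' : Type) (phi : X' -> X) (psi : Y' -> Y)
    (om : O -> O') (p : protocol X Y O) : protocol X' Y' O' :=
  match p with
  | Leaf o => Leaf _ _ (om o)
  | Alice c p0 p1 =>
      Alice (c \o phi) (pullback phi psi om p0) (pullback phi psi om p1)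
  | Bob c p0 p1 =>
      Bob (c \o psi) (pullback phi psi om p0) (pullback phi psi om p1)
  end.

Lemma run_pullback (X Y O X' Y' O' : Type) (phi : X' -> X) (psi : Y' -> Y)
    (om : O -> O') (p : protocol X Y O) x y :
  run (pullback phi psi om p) x y = om (run p (phi x) (psi y)).
Proof.
by elim: p => [o|c p0 IH0 p1 IH1|c p0 IH0 p1 IH1] //=; rewrite IH0 IH1; case: ifP.
Qed.

Lemma leaves_pullback (X Y O X' Y' O' : Type) (phi : X' -> X) (psi : Y' -> Y)
    (om : O -> O') (p : protocol X Y O) :
  leaves (pullback phi psi om p) = leaves p.
Proof. by elim: p => //= c p0 -> p1 ->. Qed.

Lemma leaves_gt0 (X Y O : Type) (p : protocol X Y O) : 0 < leaves p.
Proof. by elim: p => //= c p0 IH0 p1 IH1; rewrite addn_gt0 IH0. Qed.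

(** * Reducing the composition to the inner function *)

(** At a true input of least weight, switching off any of its ones makes [f] false; [k] is such a
    one. *)
Lemma monotone_critical (I : finType) (f : {ffun I -> bool} -> bool) :
  monotone f -> nonconstant f -> exists (a : {ffun I -> bool}) (k : I),
    forall b, f [ffun i => if i == k then b else a i] = b.
Proof.
move=> mon [x0 [y0 xy]].
have [z fz] : exists z, f z.
  by case: (boolP (f x0)) xy => fx xy; [exists x0 | exists y0; move: xy; case: (f y0)].
have [z' fz'] : exists z, ~~ f z.
  by case: (boolP (f x0)) xy => fx xy; [exists y0; move: xy; case: (f y0) | exists x0].
case: (arg_minnP (fun a : {ffun I -> bool} => #|[set i | a i]|) fz) => a fa amin.
have [k ak] : exists k, a k.
  apply/existsP; apply: contraNT fz' => /existsPn a0.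
  by apply: (implyP (mon _ _ _) fa) => i; rewrite (negbTE (a0 i)).
exists a, k => -[].
  apply: etrans fa; congr f; apply/ffunP => i; rewrite ffunE.
  by case: eqP => [->|].
apply/negbTE/negP => /amin; apply/negP; rewrite -ltnNge; apply: proper_card.
apply/properP; split; last by exists k; rewrite !inE // ffunE eqxx.
by apply/subsetP => i; rewrite !inE ffunE; case: eqP.
Qed.

(** Both players place their input in the critical block [k] and fill the other blocks with the same
    values, so a separating coordinate can only lie in block [k]. *)
Lemma bcomp_inner_protocol (I J : finType) (f : {ffun I -> bool} -> bool)
    (g : {ffun J -> bool} -> bool) (p : protocol _ _ _) :
  monotone f -> nonconstant f -> nonconstant g ->
  solves (mKW (bcomp f g)) p ->
  exists q, solves (mKW g) q /\ leaves q = leaves p.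
Proof.
move=> monf ncf [x0 [y0 xy]] solp.
have [a [k fk]] := monotone_critical monf ncf.
have [u gu] : exists u : bool -> {ffun J -> bool}, forall b, g (u b) = b.
  case: (boolP (g x0)) xy => gx; case: (boolP (g y0)) => // gy _.
    by exists (fun b => if b then x0 else y0) => -[] //; apply/negbTE.
  by exists (fun b => if b then y0 else x0) => -[] //; apply/negbTE.
pose lift (x : {ffun J -> bool}) : {ffun I * J -> bool} :=
  [ffun ij => if ij.1 == k then x ij.2 else u (a ij.1) ij.2].
have liftE x : bcomp f g (lift x) = g x.
  rewrite -[RHS]fk; congr f; apply/ffunP => i; rewrite !ffunE.
  case: (eqVneq i k) => [->|ik].
    by congr g; apply/ffunP => j; rewrite !ffunE eqxx.
  by rewrite -[RHS]gu; congr g; apply/ffunP => j; rewrite !ffunE /= (negbTE ik).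
have phiP (x : {x | g x}) : bcomp f g (lift (val x)) by rewrite liftE (valP x).
pose phi (x : {x | g x}) : {x | bcomp f g x} :=
  exist (fun z => is_true (bcomp f g z)) _ (phiP x).
have psiP (y : {y | ~~ g y}) : ~~ bcomp f g (lift (val y)).
  by rewrite liftE (valP y).
pose psi (y : {y | ~~ g y}) : {y | ~~ bcomp f g y} :=
  exist (fun z => is_true (~~ bcomp f g z)) _ (psiP y).
exists (pullback phi psi snd p); split; last exact: leaves_pullback.
move=> x y; have := solp (phi x) (psi y).
rewrite run_pullback; case: (run p _ _) => i j; rewrite /mKW /= !ffunE /=.
by case: ifP => // _; case: (u (a i) j).
Qed.


(** * The rank bound *)

Lemma mxrank_sum (F : fieldType) (m n : nat) (I : finType) (P : pred I)
    (M : I -> 'M[F]_(m, n)) (K : nat) :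
  (forall i, P i -> \rank (M i) <= K) ->
  \rank (\sum_(i | P i) M i)%R <= #|[pred i | P i]| * K.
Proof.
move=> rM; rewrite -sum_nat_const.
elim/big_ind2: _ => [|A a B b Aa Bb|//]; first by rewrite mxrank0.
by apply: leq_trans (mxrank_add _ _) (leq_add Aa Bb).
Qed.

Section GapRank.

Variables (V T : finType).
Variables (src : pred V) (p1 p2 : V -> V) (sink : V) (e : {set V} -> bool) (d : nat).
Hypothesis e_size : forall S, e S -> #|S| <= d.
Hypothesis e_empty : e set0.
Hypothesis e_sink : forall S : {set V}, sink \in S -> ~~ e S.
Hypothesis e_move : forall (S : {set V}) v, v \notin S -> #|S| < d ->
  src v || (p1 v \in S) && (p2 v \in S) -> e (v |: S) = e S.

Local Open Scope ring_scope.

Lemma F2_addrr (x : 'F_2) : x + x = 0.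
Proof. exact/addrr_pchar2/pchar_Fp. Qed.

(** Pairs the sets along the involution toggling [v]; the cancellations over GF(2) below all start
    from this form. *)
Lemma sum_pairs (v : V) (F : {set V} -> 'F_2) :
  \sum_S F S = \sum_(S : {set V} | v \notin S) (F S + F (v |: S)).
Proof.
rewrite (bigID (fun S : {set V} => v \notin S)) big_split /=; congr (_ + _).
rewrite (reindex_onto (fun S : {set V} => v |: S) (fun S => S :\ v)) /=; last first.
  by move=> S; rewrite negbK => vS; rewrite setD1K.
apply: eq_bigl => S; rewrite negbK setU11 /=.
apply/eqP/idP => [<-|vS]; first by rewrite !inE eqxx.
by rewrite setU1K.
Qed.

(* Moebius inversion of [e]: over GF(2), the sum of [gap] over the supersets
   of S is [e S]. *)
Definition gap (z : {set V}) : 'F_2 := \sum_(S : {set V} | z \subset S) (e S)%:R.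

Definition falsifies (z : {set V}) (v : V) :=
  (v \notin z) && (src v || (p1 v \in z) && (p2 v \in z)).

(* The sets S and v |: S cancel in pairs, unless they straddle the size bound. *)
Lemma gap_falsifies z v : falsifies z v ->
  gap z = \sum_(S : {set V} | #|S| == d)
            ((v \notin S) && e S)%:R * (z \subset S)%:R.
Proof.
move=> /andP[vz prem]; rewrite /gap big_mkcond (sum_pairs v) /=.
rewrite [LHS]big_mkcond [RHS]big_mkcond; apply: eq_bigr => S _.
have [vS|vS] /= := boolP (v \in S); first by rewrite mul0r if_same.
have -> : (z \subset v |: S) = (z \subset S).
  apply/subsetP/subsetP => zS u uz; last by rewrite inE zS // orbT.
  by have := zS u uz; rewrite !inE; case: eqP => // uv; rewrite -uv uz in vz.
have [zS|_] := boolP (z \subset S); last by rewrite mulr0 addr0 if_same.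
rewrite mulr1; case: ltngtP => [Sd|Sd|Sd].
- rewrite e_move ?F2_addrr //.
  case/orP: prem => [->//|/andP[/(subsetP zS)-> /(subsetP zS)->]].
  by rewrite orbT.
- rewrite (negbTE (contraNN (@e_size S) _)) -?ltnNge //.
  rewrite (negbTE (contraNN (@e_size (v |: S)) _)) ?addr0 // -ltnNge.
  by rewrite cardsU1 vS ltnS ltnW.
- rewrite (negbTE (contraNN (@e_size (v |: S)) _)) ?addr0 //.
  by rewrite -ltnNge cardsU1 vS Sd.
Qed.

Lemma gap_sink (z : {set V}) : sink \in z -> gap z = 0.
Proof.
move=> sz; apply: big1 => S /subsetP/(_ _ sz) sS.
by rewrite (negbTE (e_sink sS)).
Qed.

Definition agree (a b : {ffun V -> T}) (w : {set V}) : {set V} :=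
  [set v in w | a v == b v].

(** If [a = b], each S is counted once per subset, 2^|S| times, which is odd only for the empty set.
    Otherwise, toggling in [w] a vertex where [a] and [b] differ leaves [agree] unchanged, and the
    terms cancel. *)
Lemma sum_gap_agree a b : \sum_w gap (agree a b w) = (a == b)%:R.
Proof.
have [<-|/eqP ab] := eqVneq a b.
  under eq_bigr => w _.
    have -> : agree a a w = w by apply/setP => v; rewrite inE eqxx andbT.
    over.
  rewrite (exchange_big_dep xpredT) //= (bigD1 set0) //= [X in _ + X]big1.
    rewrite addr0 (eq_bigl (pred1 set0)) => [|S]; last by rewrite subset0.
    by rewrite big_pred1_eq e_empty.
  move=> S /set0Pn[v vS]; rewrite big_mkcond (sum_pairs v).
  by apply: big1 => w vw; rewrite subUset sub1set vS F2_addrr.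
have [v abv] : exists v, a v != b v.
  apply/existsP; apply: contra_notT ab => /existsPn ab; apply/ffunP => v.
  by apply/eqP; have := ab v; rewrite negbK.
rewrite (sum_pairs v); apply: big1 => w vw; rewrite -[X in gap X]/(agree a b w).
suff -> : agree a b (v |: w) = agree a b w by rewrite F2_addrr.
apply/setP => u; rewrite !inE; case: (eqVneq u v) => [->|//].
by rewrite (negbTE abv) !andbF.
Qed.

Local Notation A := {ffun V -> T}.
Local Notation B := ({set V} * {ffun V -> T})%type.

(** Bob's set [w] is summed inside the entries, so the matrix is additive under splits on either
    side and yet indexed by labelings only. *)
Definition rectmx (alpha : A -> bool) (beta : B -> bool) : 'M['F_2]_#|A| :=
  \matrix_(i, j) \sum_w (alpha (enum_val i) && beta (w, enum_val j))%:R *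
     gap (agree (enum_val i) (enum_val j) w).

Lemma rectmxT : rectmx xpredT xpredT = 1%:M.
Proof.
apply/matrixP => i j; rewrite !mxE; under eq_bigr do rewrite mul1r.
by rewrite sum_gap_agree (inj_eq enum_val_inj).
Qed.

(** For fixed S, the condition that S contains [agree a b w] constrains [a] only outside S, so the
    matrix of S factors through the labelings of the complement of S. *)
Lemma rank_rectmx_falsifies (alpha : A -> bool) (beta : B -> bool) (v : V) :
  (forall a w b, alpha a -> beta (w, b) -> falsifies (agree a b w) v) ->
  (\rank (rectmx alpha beta) <= 'C(#|V|, d) * #|T| ^ (#|V| - d))%N.
Proof.
move=> fals.
pose rest (S : {set V}) := {ffun {u : V | u \notin S} -> T}.
pose M (S : {set V}) : 'M['F_2]_(#|A|, #|{: rest S}|) := \matrix_(i, c)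
  (alpha (enum_val i) && (enum_val c == [ffun u => (enum_val i : A) (val u)]))%:R.
pose M' (S : {set V}) : 'M['F_2]_(#|{: rest S}|, #|A|) := \matrix_(c, j)
  \sum_w (beta (w, enum_val j))%:R * ((v \notin S) && e S)%:R *
     [forall u : {u | u \notin S}, (val u \in w) ==>
        ((enum_val c : rest S) u != (enum_val j : A) (val u))]%:R.
have -> : rectmx alpha beta = \sum_(S : {set V} | #|S| == d) M S *m M' S.
  apply/matrixP => i j; rewrite summxE mxE.
  set a : A := enum_val i; set b : A := enum_val j.
  under [RHS]eq_bigr => S Sd.
    (* Only the restriction of [a] to the complement of S selects a nonzero term. *)
    rewrite mxE (bigD1 (enum_rank ([ffun u => a (val u)] : rest S))) //=.
    rewrite big1 ?addr0; last first.
      move=> c ca; rewrite mxE; case: eqP => [cE|_]; last by rewrite andbF mul0r.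
      by rewrite -cE enum_valK eqxx in ca.
    rewrite !mxE enum_rankK eqxx andbT mulr_sumr.
    over.
  rewrite exchange_big; apply: eq_bigr => w _ /=.
  rewrite -/a -/b; case: (boolP (alpha a)) => aa /=; last first.
    by rewrite mul0r big1 // => S _; rewrite mul0r.
  case: (boolP (beta (w, b))) => bb /=; last first.
    by rewrite mul0r big1 // => S _; rewrite !mul0r mulr0.
  rewrite mul1r (gap_falsifies (fals _ _ _ aa bb)).
  apply: eq_bigr => S _; rewrite !mul1r; congr (_ * (nat_of_bool _)%:R).
  apply/subsetP/forallP => [zS u|zS u].
    apply/implyP => uw; apply: contraNN (valP u) => /eqP ab; apply: zS.
    by rewrite inE uw -ab ffunE eqxx.
  rewrite inE => /andP[uw ab]; apply: contraTT ab => uS.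
  by have := implyP (zS (exist _ u uS)) uw; rewrite ffunE.
have cardP : #|[pred S : {set V} | #|S| == d]| = 'C(#|V|, d).
  by rewrite -card_draws; apply: eq_card => S; rewrite !inE.
rewrite -cardP; apply: mxrank_sum => S /eqP Sd.
apply: leq_trans (mxrankM_maxl _ _) (leq_trans (rank_leq_col _) _).
rewrite card_ffun card_sig; apply: eq_leq; congr (_ ^ _)%N.
rewrite -Sd; have := cardsCs (~: S); rewrite setCK => <-.
by apply: eq_card => u; rewrite !inE.
Qed.

(** The full rectangle carries the identity matrix, and rank is the subadditive measure: a leaf that
    forces the sink into [agree] carries the zero matrix, any other leaf has a common falsified
    vertex. *)
Lemma gap_leaves (X Y O : Type) (phi : A -> X) (psi : B -> Y)
    (p : protocol X Y O) (valid : A -> B -> O -> Prop) :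
  (forall o, (forall a w b, valid a (w, b) o -> sink \in agree a b w) \/
     exists v, forall a w b, valid a (w, b) o -> falsifies (agree a b w) v) ->
  (forall a b, valid a b (run p (phi a) (psi b))) ->
  (#|T| ^ #|V| <= leaves p * ('C(#|V|, d) * #|T| ^ (#|V| - d)))%N.
Proof.
move=> headP ok; rewrite -card_ffun -[X in (X <= _)%N](mxrank1 'F_2) -rectmxT.
apply: (leaves_subadditive (mu := fun al be => \rank (rectmx al be))
  (phi := phi) (psi := psi) (valid := valid)) => [al be c|al be c|al be o val_o|//].
- apply: leq_trans (mxrank_add _ _); apply: eq_leq; congr (\rank _).
  apply/matrixP => i j; rewrite !mxE -big_split; apply: eq_bigr => w _ /=.
  by rewrite -mulrDl; case: (al _); case: (c _); rewrite /= ?addr0 ?add0r.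
- apply: leq_trans (mxrank_add _ _); apply: eq_leq; congr (\rank _).
  apply/matrixP => i j; rewrite !mxE -big_split; apply: eq_bigr => w _ /=.
  rewrite -mulrDl; case: (al _); case: (be _); case: (c _);
    by rewrite /= ?addr0 ?add0r.
- have [sinko|[v vo]] := headP o.
    suff -> : rectmx al be = 0 by rewrite mxrank0.
    apply/matrixP => i j; rewrite !mxE big1 // => w _.
    have [/andP[aa bb]|_] := boolP (_ && _); last by rewrite mul0r.
    by rewrite gap_sink ?mulr0 //; apply: sinko (val_o _ _ aa bb).
  by apply: (@rank_rectmx_falsifies _ _ v) => a w b aa bb; apply/vo/val_o.
Qed.

End GapRank.


(** * Pebbling the grid *)

Section Grid.

Variable h : nat.

Definition grid : finType := ('I_h.+1 * 'I_h.+1)%type.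
Implicit Types (S : {set grid}) (u v : grid).

Definition border v := (v.1 == ord0) || (v.2 == ord0).
(** Truncated subtraction makes [above v] equal to [v] on row 0, and likewise [left_of v] on column
    0. *)
Definition above v : grid := (inord v.1.-1, v.2).
Definition left_of v : grid := (v.1, inord v.2.-1).
Definition corner : grid := (ord_max, ord_max).

Definition level v : nat := v.1 + v.2.

Lemma inner_level v : ~~ border v ->
  level (above v) < level v /\ level (left_of v) < level v.
Proof.
case: v => -[[|i] lti] [[|j] ltj] //= _.
by rewrite /level /= !inordK ?addSn ?addnS // ltnW.
Qed.

(* [exposed S v]: an S-free monotone path leads from the border to [v]. *)
Inductive exposed S : grid -> Prop :=
| exposed_border v : v \notin S -> border v -> exposed S v
| exposed_above v : v \notin S -> exposed S (above v) -> exposed S v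
| exposed_left v : v \notin S -> exposed S (left_of v) -> exposed S v.

Lemma exposed_notin S v : exposed S v -> v \notin S.
Proof. by case. Qed.

Lemma exposed_antimono S S' v : S' \subset S -> exposed S v -> exposed S' v.
Proof.
move=> /subsetP sub; have notin u : u \notin S -> u \notin S'.
  by apply: contraNN; apply: sub.
elim=> {}v /notin vS; first exact: exposed_border.
  by move=> _; apply: exposed_above.
by move=> _; apply: exposed_left.
Qed.

(** A non-border vertex whose two predecessors are blocked is itself unexposed, so pebbling it cuts
    no free path. *)
Lemma exposed_inner S v u : ~~ border v -> above v \in S -> left_of v \in S ->
  exposed S u -> exposed (v |: S) u.
Proof.
move=> vb va vl; have nv : ~ exposed S v.
  move=> ev; move: vb va vl; case: ev => {}v _; first by move=> ->.
    by move=> /exposed_notin/negbTE ->.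
  by move=> /exposed_notin/negbTE ->.
have notin w : exposed S w -> w \notin v |: S.
  move=> ew; rewrite in_setU1 negb_or (exposed_notin ew) andbT.
  by apply/eqP => wv; apply: nv; rewrite -wv.
move=> eu; elim: (eu) => {eu}u uS; first move=> ub.
- by apply: exposed_border => //; apply: notin; apply: exposed_border.
- by move=> eu IH; apply: exposed_above => //; apply: notin; apply: exposed_above.
- by move=> eu IH; apply: exposed_left => //; apply: notin; apply: exposed_left.
Qed.

(** At most [h] pebbles cannot meet all [h + 1] columns. *)
Lemma free_column S : #|S| <= h -> exists j : 'I_h.+1, forall i, (i, j) \notin S.
Proof.
move=> Sh; have /subsetPn[j _ jS] : ~~ ([set: 'I_h.+1] \subset [set v.2 | v in S]).
  apply: contraL Sh => /subset_leq_card; rewrite cardsT card_ord -ltnNge => lt.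
  exact: leq_trans lt (leq_imset_card _ _).
by exists j => i; apply: contraNN jS => ijS; apply/imsetP; exists (i, j).
Qed.

Lemma exposed_column S j u :
  (forall i, (i, j) \notin S) -> u.2 = j -> exposed S u.
Proof.
move=> free; case: u => i _ /= ->; case: i => i.
elim: i => [|i IH] lt; first by apply: exposed_border.
apply: exposed_above => //; rewrite /above /=.
have lt' : i < h.+1 by apply: ltnW.
suff -> : inord i = Ordinal lt' by [].
by apply: val_inj; rewrite /= inordK.
Qed.

Lemma exposed_empty : exposed set0 corner.
Proof. by apply: (@exposed_column _ ord_max) => // i; rewrite inE. Qed.

(* A free column j > 0 survives the move, and the part of the old path to the
   right of column j does not meet column 0. *)
Lemma exposed_first_column S v : v.2 = ord0 -> #|v |: S| <= h ->
  exposed S corner -> exposed (v |: S) corner.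
Proof.
move=> v0 /free_column[j free].
have j0 : 0 < j.
  rewrite lt0n; apply: contraNneq (free v.1) => j0.
  have -> : j = v.2 by rewrite v0; apply: val_inj.
  by rewrite -surjective_pairing setU11.
suff gen u : exposed S u -> j <= u.2 -> exposed (v |: S) u.
  by move/gen; apply; rewrite /= -ltnS.
have notin w : w \notin S -> j <= w.2 -> w \notin v |: S.
  move=> wS jw; rewrite in_setU1 negb_or wS andbT.
  by apply: contraTneq jw => ->; rewrite v0 -ltnNge.
elim=> {}u uS.
- by move=> ub ju; apply: exposed_border => //; apply: notin.
- by move=> _ IH ju; apply: exposed_above; [apply: notin | apply: IH].
(* On column [j] the rest of the path is replaced by the free column; strictly to its right, a step
   to the left keeps the column index at least [j]. *)
- move=> _ IH; rewrite leq_eqVlt => /orP[/eqP ju|ju].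
    by apply: (exposed_column free); apply: val_inj.
  apply: exposed_left; first by apply: notin => //; apply: ltnW.
  apply: IH; rewrite /= inordK -ltnS ?prednK ?(leq_trans _ ju) //.
  exact: leq_trans (ltn_ord u.2) _.
Qed.

Definition transpose v : grid := (v.2, v.1).

Lemma transposeK : involutive transpose.
Proof. by case. Qed.

Lemma exposed_transpose S v :
  exposed S v -> exposed (transpose @: S) (transpose v).
Proof.
have notin u : u \notin S -> transpose u \notin transpose @: S.
  by rewrite mem_imset //; apply: inv_inj transposeK.
elim=> {}v /notin vS.
- by move=> vb; apply: exposed_border; rewrite // /border orbC.
- by move=> _ IH; apply: exposed_left.
- by move=> _ IH; apply: exposed_above.
Qed.

Lemma exposed_first_row S v : v.1 = ord0 -> #|v |: S| <= h ->
  exposed S corner -> exposed (v |: S) corner.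
Proof.
move=> v0 cS /exposed_transpose eS.
have tr : transpose @: (v |: S) = transpose v |: transpose @: S.
  by rewrite imsetU1.
have : exposed (transpose @: (v |: S)) corner.
  rewrite tr; apply: exposed_first_column => //.
  by rewrite -tr card_imset //; apply: inv_inj transposeK.
move/exposed_transpose; rewrite -imset_comp (eq_imset _ transposeK).
by rewrite imset_id.
Qed.

Definition pebbling S : bool := (#|S| <= h) && `[< exposed S corner >].

Lemma pebbling_size S : pebbling S -> #|S| <= h.
Proof. by case/andP. Qed.

Lemma pebbling_empty : pebbling set0.
Proof. by rewrite /pebbling cards0; apply/asboolP/exposed_empty. Qed.

Lemma pebbling_corner S : corner \in S -> ~~ pebbling S.
Proof.
by move=> cS; apply/negP => /andP[_ /asboolP/exposed_notin]; rewrite cS.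
Qed.

(** Lifting a pebble never blocks a path. Placing one on the border leaves a free row or column as a
    detour; placing one inside covers a vertex already cut off. *)
Lemma pebbling_move S v : v \notin S -> #|S| < h ->
  border v || (above v \in S) && (left_of v \in S) -> pebbling (v |: S) = pebbling S.
Proof.
move=> vS Sh prem; have vSh : #|v |: S| <= h by rewrite cardsU1 vS.
rewrite /pebbling vSh (ltnW Sh) /=; apply/asboolP/asboolP.
  by apply: exposed_antimono; apply: subsetUr.
case: (boolP (border v)) prem => [/orP[/eqP v0|/eqP v0] _|vb /= /andP[va vl]].
- exact: exposed_first_row.
- exact: exposed_first_column.
- exact: exposed_inner.
Qed.

End Grid.


(** * Generation *)

Lemma bin_leq_expn m k : 'C(m, k) <= m ^ k.
Proof.
apply: (@leq_trans (m ^_ k)); first by rewrite -bin_ffact leq_pmulr ?fact_gt0.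
rewrite ffact_prod -[k in _ <= _ ^ k]card_ord -prod_nat_const.
by apply: leq_prod => i _; apply: leq_subr.
Qed.

Section GenLowerBound.

Variables (h : nat) (T : finType) (n : nat).
Hypothesis n_large : #|{: grid h * T}| <= n.

Local Notation V := (grid h).
Local Notation A := {ffun grid h -> T}.
Local Notation point := 'I_n.+2.

(** The shift leaves index 0 to [one], and [n_large] keeps index [n + 1] free for [target]. *)
Definition pt (v : V) (i : T) : point := inord (enum_rank (v, i)).+1.
Definition one : point := ord0.
Definition target : point := ord_max.

Lemma val_pt v i : val (pt v i) = (enum_rank (v, i)).+1.
Proof.
rewrite /pt /= inordK // !ltnS; apply: leq_trans (ltnW (ltn_ord _)) n_large.
Qed.

Lemma pt_inj v i v' i' : pt v i = pt v' i' -> v = v' /\ i = i'.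
Proof.
move/(congr1 val); rewrite !val_pt => -[/ord_inj/enum_rank_inj].
by move=> /= [-> ->].
Qed.

Lemma pt_one v i : (pt v i == one) = false.
Proof. by apply/negbTE/eqP => /(congr1 val); rewrite val_pt. Qed.

Lemma pt_target v i : (pt v i == target) = false.
Proof.
apply/negbTE/eqP => /(congr1 val); rewrite val_pt /= => -[eq].
by have := leq_trans (ltn_ord (enum_rank (v, i))) n_large; rewrite eq ltnn.
Qed.

Definition rule (a : A) (v : V) : point * point * point :=
  (if border v then (one, one)
   else (pt (above v) (a (above v)), pt (left_of v) (a (left_of v))),
   pt v (a v)).

Definition last_rule (a : A) : point * point * point :=
  let c := corner h in (pt c (a c), pt c (a c), target).

Definition alice_input (a : A) : {ffun point * point * point -> bool} :=
  [ffun t => (t == last_rule a) || [exists v, t == rule a v]].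

Definition bob_points (wb : {set V} * A) : {set point} :=
  one |: [set pt v (wb.2 v) | v in wb.1].

(** The largest input under which [bob_points] is closed. *)
Definition bob_input (wb : {set V} * A) : {ffun point * point * point -> bool} :=
  [ffun t => ~~ [&& t.1.1 \in bob_points wb, t.1.2 \in bob_points wb
                  & t.2 \notin bob_points wb]].

Lemma Gen_alice_input a : Gen n.+2 (alice_input a).
Proof.
have gen_pt v : generates [set t | alice_input a t] (pt v (a v)).
  have [k] := ubnP (level v); elim: k v => // k IH v /ltnSE vk.
  have one_gen : generates [set t | alice_input a t] one by apply: generates_one.
  have in_rule : rule a v \in [set t | alice_input a t].
    by rewrite inE ffunE; apply/orP; right; apply/existsP; exists v.
  have [vb|vb] := boolP (border v).
    by rewrite /rule vb in in_rule; apply: (generates_triplet in_rule one_gen one_gen).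
  rewrite /rule (negbTE vb) in in_rule; have [up left] := inner_level vb.
  by apply: (generates_triplet in_rule); apply: IH; apply: leq_trans vk.
apply/asboolP; exists target; split=> //.
apply: (generates_triplet _ (gen_pt (corner h)) (gen_pt (corner h))).
by rewrite inE ffunE eqxx.
Qed.

Lemma pt_bob_points w b v i :
  (pt v i \in bob_points (w, b)) = (v \in w) && (b v == i).
Proof.
rewrite /bob_points in_setU1 pt_one /=; apply/imsetP/andP => [[u uw]|[vw /eqP bv]].
  by case/pt_inj => -> ->.
by exists v; rewrite // bv.
Qed.

Lemma Gen_bob_input wb : ~~ Gen n.+2 (bob_input wb).
Proof.
apply/asboolP => -[_ [/= /(@ord_inj _ _ target) -> gen]].
suff : target \in bob_points wb.
  rewrite in_setU1 => /orP[/eqP/(congr1 val)//|/imsetP[v _ /esym/eqP]].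
  by rewrite pt_target.
elim: gen => [u u0|u v u' + _ uS _ vS].
  by rewrite in_setU1; apply/orP; left; apply/eqP/val_inj.
by rewrite inE ffunE /= uS vS negbK.
Qed.

Definition separates (a : A) (wb : {set V} * A) (t : point * point * point) :=
  alice_input a t && ~~ bob_input wb t.

(** The conclusion of [t] decides: [target] forces the last rule, whose premises put the corner in
    [agree]; a lifted point of [v] forces the rule of [v], which is then falsified. *)
Lemma separates_falsified t :
  (forall a w b, separates a (w, b) t -> corner h \in agree a b w) \/
  exists v, forall a w b, separates a (w, b) t ->
    falsifies (@border h) (@above h) (@left_of h) (agree a b w) v.
Proof.
have agreeE (a b : A) w v : (v \in agree a b w) = (pt v (a v) \in bob_points (w, b)).
  by rewrite pt_bob_points inE eq_sym.
have [tt|tt] := eqVneq t.2 target.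
  left=> a w b /andP[]; rewrite !ffunE negbK => /orP[/eqP -> /and3P[]|].
    by rewrite agreeE.
  case/existsP=> v /eqP tv; move/eqP: tt; rewrite tv /=.
  by rewrite pt_target.
right; have [[v i]|no] := pickP (fun vi : V * T => t.2 == pt vi.1 vi.2).
  move=> /eqP /= tv; exists v => a w b /andP[]; rewrite !ffunE negbK.
  case/orP=> [/eqP tl|/existsP[u /eqP tu]]; first by rewrite tl eqxx in tt.
  have /pt_inj[uv _] : pt u (a u) = pt v i by rewrite -tv tu.
  rewrite /falsifies !agreeE tu -uv /= => /and3P[m1 m2 ->] /=.
  by move: m1 m2; case: (border u) => //= -> ->.
(* No rule of Alice concludes in such a point, so any vertex serves. *)
exists (corner h) => a w b /andP[]; rewrite !ffunE => /orP[/eqP tl|].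
  by rewrite tl eqxx in tt.
by case/existsP=> u /eqP tu; have := no (u, a u); rewrite tu eqxx.
Qed.

Lemma Gen_leaves (p : protocol _ _ _) : solves (mKW (Gen n.+2)) p ->
  #|T| ^ h <= leaves p * (h.+1 * h.+1) ^ h.
Proof.
move=> solp.
(* The empty alphabet is treated apart because a power of [#|T|] is cancelled below. *)
have [->|T0] := posnP #|T|.
  case: (h) => [|k]; last by rewrite exp0n.
  by rewrite !expn0 muln1 leaves_gt0.
pose phi (a : A) : {x | Gen n.+2 x} :=
  exist (fun x => is_true (Gen n.+2 x)) _ (Gen_alice_input a).
pose psi (wb : {set V} * A) : {y | ~~ Gen n.+2 y} :=
  exist (fun y => is_true (~~ Gen n.+2 y)) _ (Gen_bob_input wb).
have := gap_leaves (@pebbling_size h) (@pebbling_empty h) (@pebbling_corner h)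
  (@pebbling_move h) (phi := phi) (psi := psi) (p := p) (valid := separates)
  separates_falsified (fun a wb => solp (phi a) (psi wb)).
have -> : #|grid h| = h.+1 * h.+1 by rewrite card_prod card_ord.
have hN : h <= h.+1 * h.+1 by lia.
(* Cancelling |T|^(|V|-h) leaves |T|^h on the left and the binomial coefficient on the right. *)
rewrite -{1}(subnK hN) addnC expnD mulnA leq_pmul2r ?expn_gt0 ?T0 //.
move=> /leq_trans; apply; rewrite leq_mul2l; apply/orP; right.
exact: bin_leq_expn.
Qed.

End GenLowerBound.

(** * The lower bound *)


Lemma Gen_nonconstant n : 1 < n -> nonconstant (Gen n).
Proof.
by move=> n1; exists [ffun=> true], [ffun=> false]; rewrite Gen0 // Gen1 // ltnW.
Qed.

(* Alphabet of size 2 (h+1)^2, i.e. twice the number of vertices of the grid. *)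
Lemma L_bcomp_Gen m (f : {ffun 'I_m -> bool} -> bool) (n h : nat) :
  monotone f -> nonconstant f -> 2 * h.+1 ^ 4 + 2 <= n ->
  2 ^ h <= L (mKW (bcomp f (Gen n))).
Proof.
move=> monf ncf; case: n => [|[|n]]; rewrite ?addn2 // => /ltnSE/ltnSE hn.
have [[p [solp <-]] _] := LP (bcomp_Gen_solvable monf ncf (isT : 1 < n.+2)).
have ncG := Gen_nonconstant (isT : 1 < n.+2).
have [q [solq <-]] := bcomp_inner_protocol monf ncf ncG solp.
have large : #|{: grid h * 'I_(2 * (h.+1 * h.+1))}| <= n.
  by rewrite !card_prod !card_ord; apply: leq_trans hn; rewrite !expnS; lia.
have := Gen_leaves large solq.
(* The factor 2 in the alphabet size survives the cancellation as 2^h. *)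
by rewrite card_ord expnMn leq_pmul2r // expn_gt0.
Qed.

(** The threshold on n is chosen before [f], so the bound has to be uniform over the finitely many
    functions on [m] bits. *)
Lemma L_mKW_bound m :
  exists c, forall f : {ffun 'I_m -> bool} -> bool, L (mKW f) <= c.
Proof.
exists (\max_(g : {ffun {ffun 'I_m -> bool} -> bool}) L (mKW g)) => f.
have fE : finfun f = f :> ({ffun 'I_m -> bool} -> bool).
  by apply/funext => x; rewrite ffunE.
pose F (g : {ffun {ffun 'I_m -> bool} -> bool}) := L (mKW g).
by have := leq_bigmax (F := F) (finfun f); rewrite /F fE.
Qed.

Lemma root8 n : exists s, s ^ 8 <= n < s.+1 ^ 8.
Proof.
have ex : exists s, s ^ 8 <= n by exists 0.
have bnd s : s ^ 8 <= n -> s <= n.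
  case: s => // s; apply: leq_trans.
  by rewrite -[X in (X <= _)%N]expn1 leq_pexp2l.
case: (ex_maxnP ex bnd) => s sn smax; exists s; rewrite sn ltnNge /=.
by apply/negP => /smax; rewrite ltnn.
Qed.

Local Open Scope ring_scope.

Lemma log2_ge (R : realType) (k l : nat) : (2 ^ k <= l)%N -> k%:R <= log2 l%:R :> R.
Proof.
move=> kl; rewrite /log2 ler_pdivlMr ?ln_gt0 ?ltr1n // mulr_natl -lnXn //.
have l0 : (0 < l)%N by rewrite (leq_trans _ kl) ?expn_gt0.
by rewrite ler_ln ?posrE ?exprn_gt0 ?ltr0n // -natrX ler_nat.
Qed.

Lemma log2_le (R : realType) (l : nat) : log2 l%:R <= l%:R :> R.
Proof.
(* At 0 the convention [ln 0 = 0] applies. *)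
case: l => [|l]; first by rewrite /log2 ln0 ?mul0r.
rewrite /log2 ler_pdivrMr ?ln_gt0 ?ltr1n // mulr_natl -lnXn //.
by rewrite ler_ln ?posrE ?exprn_gt0 ?ltr0n // -natrX ler_nat ltnW // ltn_expl.
Qed.

Theorem theorem6p13 (R : realType) :
  exists eps : R, 0 < eps /\
  exists kappa : R, 0 < kappa /\
  forall m : nat, exists n0 : nat,
  forall f : {ffun 'I_m -> bool} -> bool, monotone f -> nonconstant f ->
  forall n : nat, (n0 < n)%N ->
    log2 (L (mKW (bcomp f (Gen n))))%:R >=
      log2 (L (mKW f))%:R + kappa * n%:R `^ eps :> R.
Proof.
(* A grid of parameter h needs about 2h^4 points; taking h near n^(1/8) leaves room for all
   constants. *)
exists 8%:R^-1; split; first by rewrite invr_gt0 ltr0n.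
exists 1; split=> // m.
(* This threshold forces the integer eighth root [s] of [n] to be at least [c + 8]. *)
have [c Lc] := L_mKW_bound m; exists (c.+4.+4 ^ 8)%N => f monf ncf n n_large.
have [s /andP[sn ns]] := root8 n.
have sc : (c.+4.+3 < s)%N.
  by have := ltn_trans n_large ns; rewrite ltn_exp2r.
have n_root : n%:R `^ 8%:R^-1 <= s.+1%:R :> R.
  have -> : s.+1%:R = (s.+1 ^ 8)%:R `^ 8%:R^-1 :> R.
    by rewrite natrX -powR_mulrn // -powRrM mulfV ?powRr1 // pnatr_eq0.
  by rewrite ge0_ler_powR ?invr_ge0 ?nnegrE ?ler0n // ler_nat ltnW.
have h_fits : (2 * (c + s.+1).+1 ^ 4 + 2 <= n)%N.
  apply: leq_trans sn; apply: (@leq_trans (2 * (s + s) ^ 4 + 2)).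
    by rewrite leq_add2r leq_mul2l leq_exp2r //; lia.
  have s4 : (8 ^ 4 <= s ^ 4)%N by rewrite leq_exp2r //; lia.
  rewrite addnn -mul2n expnMn (expnD s 4 4).
  by move: (s ^ 4)%N s4 => q; rewrite !expnS expn0; nia.
(* In [h = c + s.+1], the summand [c] pays for log L(mKW_f) and [s.+1] for n^(1/8). *)
apply: le_trans (log2_ge _ (L_bcomp_Gen monf ncf h_fits)).
rewrite mul1r natrD lerD //; apply: le_trans (log2_le _ _) _.
by rewrite ler_nat.
Qed.
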